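(* Let $f\in\mathbb{C}_h[z,\bar z]$ be a Hermitian polynomial in $z=(z_1,\dots,z_n)$ and let $I$ be a Hermitian ideal. If $f\in\Sigma_h^2+I$, then for every finite collection of points $p_1,\dots,p_\ell\in\mathbb{C}^n$ satisfying $g(p_j,\overline{p_k})=0$ for all $g\in I$ and all $j,k=1,\dots,\ell$, one has $$[f(p_j,\overline{p_k})]_{j,k=1}^{\ell}\ge 0.$$
   Context: $\mathbb{C}[z,\bar z]$ is the polynomial algebra in $z=(z_1,\dots,z_n)$ and $\bar z=(\bar z_1,\dots,\bar z_n)$, treated as independent variables, with involution $f\mapsto f^*$ that conjugates coefficients and swaps $z$ and $\bar z$. $\mathbb{C}_h[z,\bar z]=\{f:f=f^*\}$ is the real algebra of Hermitian polynomials; a Hermitian ideal is an ideal of $\mathbb{C}_h[z,\bar z]$. $\Sigma_h^2\subset\mathbb{C}_h[z,\bar z]$ is the set of finite sums of Hermitian squares $|h(z)|^2=h(z)\overline{h(z)}$ with $h\in\mathbb{C}[z]$ a holomorphic polynomial. Polarization: for $f(z,\bar z)=\sum_{\alpha,\beta}a_{\alpha\beta}\bar z^\alpha z^\beta$ and $p,q\in\mathbb{C}^n$, $f(p,\bar q)=\sum_{\alpha,\beta}a_{\alpha\beta}\bar q^{\,\alpha}p^\beta$. For a matrix $M$, $M\ge0$ means positive semidefinite. *)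

(* Defs.v *)
From HB Require Import structures.
From mathcomp Require Import all_boot all_order all_algebra.
From mathcomp Require Import reals.
From mathcomp Require Import complex.
From mathcomp Require Import mpoly.
Set Implicit Arguments.
Unset Strict Implicit.
Unset Printing Implicit Defensive.

Import Order.TTheory GRing.Theory Num.Theory.
Local Open Scope ring_scope.
Local Open Scope sesquilinear_scope.

(* [{mpoly R[i][n + n]}] is the algebra C[z, zbar]: the variable z_i is
   ['X_(lshift n i)] and zbar_i is ['X_(rshift n i)]. *)

Definition swap_var (n : nat) (i : 'I_(n + n)) : 'I_(n + n) :=
  match split i with inl j => rshift n j | inr j => lshift n j end.

Definition hstar (R : realType) (n : nat) (f : {mpoly R[i][n + n]}) :
    {mpoly R[i][n + n]} :=
  mmap (@mpolyC (n + n) R[i] \o Num.conj) (fun i => 'X_(swap_var i)) f.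

Definition hermitian_poly (R : realType) (n : nat)
    (f : {mpoly R[i][n + n]}) : Prop :=
  f = hstar f.

Record hermitian_ideal (R : realType) (n : nat)
    (I : {mpoly R[i][n + n]} -> Prop) : Prop := HermitianIdeal {
  hideal_herm : forall g, I g -> hermitian_poly g;
  hideal0 : I 0;
  hidealD : forall g h, I g -> I h -> I (g + h);
  (* [a] ranges over the whole of C_h[z, zbar], in particular over the real
     constants, so [I] is also closed under opposite. *)
  hidealM : forall a g, hermitian_poly a -> I g -> I (a * g) }.

Definition holo (R : realType) (n : nat) (h : {mpoly R[i][n]}) :
    {mpoly R[i][n + n]} :=
  mmap (@mpolyC (n + n) R[i]) (fun i => 'X_(lshift n i)) h.

Definition hsquare (R : realType) (n : nat) (h : {mpoly R[i][n]}) :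
    {mpoly R[i][n + n]} :=
  holo h * hstar (holo h).

Definition sum_hsquares (R : realType) (n : nat)
    (f : {mpoly R[i][n + n]}) : Prop :=
  exists s : seq {mpoly R[i][n]}, f = \sum_(h <- s) hsquare h.

(* The value f(p, conj q): z is replaced by [p] and zbar by the conjugate
   of [q]. *)
Definition polarize (R : realType) (n : nat) (f : {mpoly R[i][n + n]})
    (p q : 'rV[R[i]]_n) : R[i] :=
  f.@[fun i => match split i with
               | inl j => p 0 j
               | inr j => (q 0 j)^*
               end].

(* On R[i], [0 <= x] means that x is real and nonnegative. *)
Definition psdmx (R : realType) (l : nat) (M : 'M[R[i]]_l) : Prop :=
  M \is hermsymmx /\
  forall v : 'cV[R[i]]_l, 0 <= (v^t* *m M *m v) 0 0.

(* Main.v *)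
(* Since [polarize] at (p, q) is a ring morphism and turns [hstar] into
   conjugation with p and q exchanged, the matrix of f is, up to terms in I
   that vanish on the chosen points, a sum of the rank-one matrices
   [h(p_j) conj(h(p_k))], whose quadratic form at v is
   |sum_j conj(v_j) h(p_j)|^2. *)
Require Import Defs.
From HB Require Import structures.
From mathcomp Require Import all_boot all_order all_algebra.
From mathcomp Require Import reals.
From mathcomp Require Import complex.
From mathcomp Require Import mpoly.
Set Implicit Arguments.
Unset Strict Implicit.
Unset Printing Implicit Defensive.

Import Order.TTheory GRing.Theory Num.Theory.
Local Open Scope ring_scope.

(** [meval], [holo] and [hstar] are all instances of [mmap], so pushing a morphism inside reduces
    identities on [polarize] to coefficients and variables. *)
Lemma rmorph_mmap (n : nat) (R S T : nzRingType) (phi : {rmorphism S -> T})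
    (c : R -> S) (x : 'I_n -> S) (p : {mpoly R[n]}) :
  phi (mmap c x p) = mmap (phi \o c) (phi \o x) p.
Proof.
rewrite /mmap rmorph_sum; apply: eq_bigr => m _.
rewrite rmorphM /mmap1 rmorph_prod; congr (_ * _).
by apply: eq_bigr => i _; rewrite rmorphXn.
Qed.

Lemma eq_mmap (n : nat) (R S : nzRingType) (c d : R -> S) (x y : 'I_n -> S) :
  c =1 d -> x =1 y -> mmap c x =1 mmap d y.
Proof.
by move=> cd xy p; apply: eq_bigr => m _; rewrite cd (mmap1_eq _ xy).
Qed.

Lemma polarize_holo (R : realType) (n : nat) (h : {mpoly R[i][n]})
    (p q : 'rV[R[i]]_n) : polarize (holo h) p q = h.@[p 0].
Proof.
rewrite /polarize /holo rmorph_mmap; apply: eq_mmap => [a|i] /=.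
  exact: mevalC.
(* [lshift n i] is convertible to [unsplit (inl i)]. *)
by rewrite mevalXU (unsplitK (inl i)).
Qed.

Lemma polarize_hstar (R : realType) (n : nat) (f : {mpoly R[i][n + n]})
    (p q : 'rV[R[i]]_n) : polarize (hstar f) p q = (polarize f q p)^*.
Proof.
rewrite /polarize /hstar !rmorph_mmap; apply: eq_mmap => [a|i] /=.
  exact: mevalC.
(* After the swap, $z_j$ takes the value $\overline{q_j}$ and $\bar z_j$ the value $p_j$, which on
   the right is $p_j$ conjugated twice. *)
rewrite mevalXU /swap_var; case: (split i) => j.
  by rewrite (unsplitK (inr j)).
by rewrite (unsplitK (inl j)) conjCK.
Qed.

Lemma polarize_hsquare (R : realType) (n : nat) (h : {mpoly R[i][n]})
    (p q : 'rV[R[i]]_n) :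
  polarize (hsquare h) p q = h.@[p 0] * (h.@[q 0])^*.
Proof.
rewrite /hsquare {1}/polarize mevalM -!/(polarize _ p q).
by rewrite polarize_hstar !polarize_holo.
Qed.

Theorem lemma1 (R : realType) (n : nat) (f : {mpoly R[i][n + n]})
    (I : {mpoly R[i][n + n]} -> Prop)
    (hf : hermitian_poly f) (hI : hermitian_ideal I)
    (hfI : exists s g : {mpoly R[i][n + n]},
        sum_hsquares s /\ I g /\ f = s + g) :
  forall (l : nat) (p : 'I_l -> 'rV[R[i]]_n),
    (forall g, I g -> forall j k : 'I_l, polarize g (p j) (p k) = 0) ->
    psdmx (\matrix_(j < l, k < l) polarize f (p j) (p k)).
Proof.
move=> l p Ip0; split.
  (* The sign in [hermsymmx] is $(-1)^0$; the symmetry itself comes from [hf]. *)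
  apply/is_hermitianmxP; rewrite expr0 scale1r; apply/matrixP => j k.
  by rewrite !mxE {1}hf polarize_hstar.
move=> v; have [_ [g [[s ->] [Ig fE]]]] := hfI.
have fpE j k : polarize f (p j) (p k) =
    \sum_(h <- s) h.@[p j 0] * (h.@[p k 0])^*.
  rewrite fE /polarize mevalD -!/(polarize _ _ _) (Ip0 g) // addr0.
  rewrite /polarize raddf_sum; apply: eq_bigr => h _.
  exact: polarize_hsquare.
suff -> : (v^t Num.conj *m (\matrix_(j < l, k < l) polarize f (p j) (p k))
      *m v)%sesqui 0 0 = \sum_(h <- s) `|\sum_j (v j 0)^* * h.@[p j 0]| ^+ 2.
  by apply: sumr_ge0 => h _; rewrite exprn_ge0.
rewrite mxE.
under eq_bigr => k _.
  rewrite mxE mulr_suml.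
  under eq_bigr => j _ do rewrite !mxE fpE mulr_sumr mulr_suml.
  over.
(* Two exchanges bring the sum over [h] outermost, so that each square is treated separately. *)
under eq_bigr => k _ do rewrite exchange_big.
rewrite exchange_big; apply: eq_bigr => h _.
(* In $|x|^2 = x\bar x$, the factor $\bar x$ supplies the outer sum over [k] and $x$ the inner sum
   over [j]. *)
rewrite normCK rmorph_sum mulr_sumr; apply: eq_bigr => k _ /=.
rewrite mulr_suml; apply: eq_bigr => j _.
by rewrite rmorphM /= conjCK !mulrA mulrAC.
Qed.
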